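(* Let $(X,d_X)$ and $(Y,d_Y)$ be metric spaces and let $\mathcal{M}:Y\rightrightarrows X$ be a set-valued mapping. Let $\overline{y}\in\operatorname{dom}\mathcal{M}$ be such that $\mathcal{M}$ is outer semicontinuous in the Painlevé-Kuratowski sense at $\overline{y}$, and assume that $\mathcal{M}$ is locally compact around $\overline{y}$. Then $$\operatorname{Lipusc}\mathcal{M}(\overline{y})=\sup_{x\in\mathcal{M}(\overline{y})}\operatorname{clm}\mathcal{M}(\overline{y},x).$$
   Context: For a set-valued mapping $\mathcal{M}:Y\rightrightarrows X$ between metric spaces, $\operatorname{dom}\mathcal{M}=\{y\in Y: \mathcal{M}(y)\neq\emptyset\}$ and $\operatorname{gph}\mathcal{M}=\{(y,x)\in Y\times X: x\in\mathcal{M}(y)\}$. The point-to-set distance is $d_X(x,\Omega)=\inf_{z\in\Omega}d_X(x,z)$, with $d_X(x,\emptyset)=+\infty$. Lipschitz upper semicontinuity modulus: for $\overline{y}\in\operatorname{dom}\mathcal{M}$, $\operatorname{Lipusc}\mathcal{M}(\overline{y})\in[0,+\infty]$ is the infimum of all $\kappa\ge 0$ for which there is a neighborhood $V$ of $\overline{y}$ with $d_X(x,\mathcal{M}(\overline{y}))\le\kappa\, d_Y(y,\overline{y})$ for all $y\in V$ and all $x\in\mathcal{M}(y)$ (with $\inf\emptyset=+\infty$). Calmness modulus: for $(\overline{y},\overline{x})\in\operatorname{gph}\mathcal{M}$, $\operatorname{clm}\mathcal{M}(\overline{y},\overline{x})\in[0,+\infty]$ is the infimum of all $\kappa\ge 0$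 for which there are neighborhoods $V$ of $\overline{y}$ and $U$ of $\overline{x}$ with $d_X(x,\mathcal{M}(\overline{y}))\le\kappa\, d_Y(y,\overline{y})$ for all $y\in V$ and all $x\in\mathcal{M}(y)\cap U$ (with $\inf\emptyset=+\infty$). Outer semicontinuity (Painlevé-Kuratowski) at $\overline{y}$: for any sequences $y_k\to\overline{y}$ and $x_k\to\overline{x}$ with $x_k\in\mathcal{M}(y_k)$ for all $k$, one has $\overline{x}\in\mathcal{M}(\overline{y})$. Locally compact around $\overline{y}$: there is a neighborhood $V$ of $\overline{y}$ whose image $\mathcal{M}(V)=\bigcup_{y\in V}\mathcal{M}(y)$ is relatively compact in $X$ (contained in a compact subset of $X$). *)

(* Defs.v *)
(* Metric spaces are [metricType R] over an arbitrary
   [R : realType]; a set-valued mapping from Y to X is a function [Y -> set X]. *)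
From HB Require Import structures.
From mathcomp Require Import all_boot all_order all_algebra.
From mathcomp Require Import all_classical all_reals all_analysis.

Set Implicit Arguments.
Unset Strict Implicit.
Unset Printing Implicit Defensive.

Import Order.TTheory GRing.Theory Num.Theory.

Local Open Scope classical_set_scope.
Local Open Scope ring_scope.
Local Open Scope ereal_scope.

(* [ereal_inf set0 = +oo] gives both d(x, set0) = +oo and a modulus equal to
   +oo when no constant [kappa] is admissible. *)

Definition set_dist (R : realType) (X : metricType R) (x : X) (A : set X) :
    \bar R :=
  ereal_inf [set (mdist x z)%:E | z in A].

Definition sv_dom (R : realType) (X Y : metricType R) (M : Y -> set X) :
    set Y :=
  [set y | M y !=set0].

Definition Lipusc (R : realType) (X Y : metricType R) (M : Y -> set X)
    (ybar : Y) : \bar R :=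
  ereal_inf [set kappa%:E | kappa in [set kappa : R | (0 <= kappa)%R /\
    exists V : set Y, nbhs ybar V /\
      forall y x, V y -> M y x ->
        set_dist x (M ybar) <= (kappa * mdist y ybar)%:E]].

(* Meant for points (ybar, xbar) of the graph of M. *)
Definition clm (R : realType) (X Y : metricType R) (M : Y -> set X)
    (ybar : Y) (xbar : X) : \bar R :=
  ereal_inf [set kappa%:E | kappa in [set kappa : R | (0 <= kappa)%R /\
    exists (V : set Y) (U : set X), [/\ nbhs ybar V, nbhs xbar U &
      forall y x, V y -> (M y `&` U) x ->
        set_dist x (M ybar) <= (kappa * mdist y ybar)%:E]]].

Definition outer_semicontinuous_at (R : realType) (X Y : metricType R)
    (M : Y -> set X) (ybar : Y) : Prop :=
  forall (y : nat -> Y) (x : nat -> X) (xbar : X),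
    y @ \oo --> ybar -> x @ \oo --> xbar ->
    (forall k, M (y k) (x k)) -> M ybar xbar.

Definition locally_compact_around (R : realType) (X Y : metricType R)
    (M : Y -> set X) (ybar : Y) : Prop :=
  exists V : set Y, nbhs ybar V /\
    exists K : set X, compact K /\ \bigcup_(y in V) M y `<=` K.

(* Main.v *)
(** The inequality [>=] holds because an admissible constant for [Lipusc] is
    admissible for every [clm]. For [<=], take [k] above the supremum. Each
    point [x] of the compact set [K] containing the values of [M] near [ybar]
    has a neighborhood [U] with a matching neighborhood [V] of [ybar] such that
    the estimate with constant [k] holds on [U] and [V]: by calmness if
    [x] is in [M ybar], and vacuously otherwise, since outer semicontinuity
    keeps [M y] away from [x] for [y] near [ybar]. Compactness of [K]
    makes [V] uniform. *)
Require Import Defs.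
From HB Require Import structures.
From mathcomp Require Import all_boot all_order all_algebra.
From mathcomp Require Import all_classical all_reals all_analysis.

Import Order.TTheory GRing.Theory Num.Theory.

Local Open Scope classical_set_scope.
Local Open Scope ereal_scope.

Lemma cvg_ball_harmonic {R : realType} {Z : pseudoMetricType R} (u : nat -> Z)
    (z : Z) :
  (forall n, ball z (n.+1%:R^-1)%R (u n)) -> u @ \oo --> z.
Proof.
move=> zu; apply/cvg_ballP => e e0.
have := near_infty_natSinv_lt (PosNum e0).
apply: filterS => n /= /ltW ne.
exact: le_ball (zu n).
Qed.

(** An infimum below [k] leaves an admissible [c < k]; enlarging [c] to [k] is harmless since
    distances are nonnegative. *)
Lemma set_dist_near_clm {R : realType} {X Y : metricType R} (M : Y -> set X)
    (ybar : Y) (xbar : X) (k : R) :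
  clm M ybar xbar < k%:E ->
  \forall x \near xbar & y \near ybar,
    M y x -> set_dist x (M ybar) <= (k * mdist y ybar)%:E.
Proof.
move=> /ereal_inf_lt[_ [c [_ [V [U [Vy Ux VU]]]] <-]]; rewrite lte_fin => ck.
exists (U, V) => //= -[x y] /= [{}Ux {}Vy] Mxy.
apply: le_trans (VU _ _ Vy (conj Mxy Ux)) _.
by rewrite lee_fin ler_wpM2r ?mdist_ge0// ltW.
Qed.

(** Otherwise, for each [n], the balls of radius [1/(n+1)] contain a pair in the graph, and choosing
    one per [n] gives sequences that contradict outer semicontinuity. *)
Lemma near_notin_outer_semicontinuous {R : realType} {X Y : metricType R}
    (M : Y -> set X) (ybar : Y) (xbar : X) :
  outer_semicontinuous_at M ybar -> ~ M ybar xbar ->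
  \forall x \near xbar & y \near ybar, ~ M y x.
Proof.
move=> osc nMx; apply: contrapT => far.
have /choice[u uP] (n : nat) : exists p : X * Y,
    [/\ ball xbar (n.+1%:R^-1)%R p.1, ball ybar (n.+1%:R^-1)%R p.2 &
        M p.2 p.1].
  apply: contrapT => noP; apply: far.
  exists (ball xbar (n.+1%:R^-1)%R, ball ybar (n.+1%:R^-1)%R).
    by split; apply: nbhsx_ballx; rewrite invr_gt0 ltr0n.
  by move=> p [px py] Mp; apply: noP; exists p.
apply/nMx/(osc (snd \o u) (fst \o u)) => [||n]; last by case: (uP n).
- by apply: cvg_ball_harmonic => n; case: (uP n).
- by apply: cvg_ball_harmonic => n; case: (uP n).
Qed.

Lemma clm_ge0 {R : realType} {X Y : metricType R} (M : Y -> set X)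
    (ybar : Y) (xbar : X) : 0 <= clm M ybar xbar.
Proof. by apply/ereal_infP => _ [k [k0 _] <-]; rewrite lee_fin. Qed.

Lemma clm_le_Lipusc {R : realType} {X Y : metricType R} (M : Y -> set X)
    (ybar : Y) (xbar : X) : clm M ybar xbar <= Lipusc M ybar.
Proof.
apply: ereal_inf_le_tmp => _ [k [k0 [V [Vy VM]]] <-].
exists k => //; split=> //; exists V, setT; split=> //; first exact: filterT.
by move=> y x Vy' [Mxy _]; exact: VM.
Qed.

Lemma Lipusc_le {R : realType} {X Y : metricType R} (M : Y -> set X)
    (ybar : Y) (k : R) :
  outer_semicontinuous_at M ybar -> locally_compact_around M ybar ->
  (0 <= k)%R -> (forall x, M ybar x -> clm M ybar x < k%:E) ->
  Lipusc M ybar <= k%:E.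
Proof.
move=> osc [V [Vy [K [cK MK]]]] k0 clmk.
have nearK : \forall y \near ybar, K `<=` [set x |
    M y x -> set_dist x (M ybar) <= (k * mdist y ybar)%:E].
  (* Near-covering form of compactness: a product neighborhood at each point of [K] yields one
     neighborhood of [ybar] for all of [K]. *)
  apply: (proj1 (compact_near_coveringP K) cK) => x _.
  have [Mx|nMx] := pselect (M ybar x); first exact/set_dist_near_clm/clmk.
  have := near_notin_outer_semicontinuous _ _ _ osc nMx.
  by apply: filterS => p nM /nM.
apply: ereal_inf_lbound; exists k => //; split=> //.
exists (V `&` [set y | K `<=` [set x |
  M y x -> set_dist x (M ybar) <= (k * mdist y ybar)%:E]]).
split; first exact: filterI.
by move=> y x [{}Vy Ky] Mxy; apply: Ky => //; apply: MK; exists y.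
Qed.

Theorem theorem1 (R : realType) (X Y : metricType R) (M : Y -> set X)
    (ybar : Y) :
  sv_dom M ybar ->
  outer_semicontinuous_at M ybar ->
  locally_compact_around M ybar ->
  Lipusc M ybar = ereal_sup [set clm M ybar x | x in M ybar].
Proof.
move=> [x0 Mx0] osc lc; apply/eqP; rewrite eq_le; apply/andP; split; last first.
  by apply/ereal_supP => _ [x _ <-]; exact: clm_le_Lipusc.
have clm_sup x : M ybar x ->
    clm M ybar x <= ereal_sup [set clm M ybar x | x in M ybar].
  by move=> Mx; apply: ereal_sup_ubound; exists x.
(* The point [x0] makes the supremum nonnegative, which excludes [-oo] and makes [s + e] a valid
   constant. *)
have := le_trans (clm_ge0 M ybar x0) (clm_sup _ Mx0).
move: (ereal_sup _) clm_sup => [s| |//] clm_sup; last by move=> _; exact: leey.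
(* The slack [e] supplies the strict bound that [Lipusc_le] asks for. *)
rewrite lee_fin => s0; apply/lee_addgt0Pr => e e0.
apply: Lipusc_le => //; first by rewrite addr_ge0// ltW.
by move=> x /clm_sup /le_lt_trans; apply; rewrite lte_fin ltrDl.
Qed.
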